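(* For all $a,b,c,d\in\Bbbk$, the element $$Z_1=a(x_1x_3+x_3x_1)+b(x_2x_4+x_4x_2)+c(x_2^2+x_4^2)+d(x_1^2+x_3^2)$$ is central in $R(a,b,c,d)$.
   Context: $\Bbbk$ is a field of characteristic not $2$. $R(a,b,c,d)$ is the free algebra $\Bbbk\langle x_1,x_2,x_3,x_4\rangle$ modulo $$ax_4x_3+bx_3x_4+cx_3x_2+dx_4x_1=0,\qquad ax_3x_2+bx_2x_3+cx_4x_3+dx_1x_2=0,$$ $$ax_2x_1+bx_1x_2+cx_1x_4+dx_2x_3=0,\qquad ax_1x_4+bx_4x_1+cx_2x_1+dx_3x_4=0,$$ $$ax_3x_1-ax_1x_3+cx_4^2-cx_2^2=0,\qquad bx_4x_2-bx_2x_4+dx_3^2-dx_1^2=0.$$ *)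

(* Defs.v *)
From HB Require Import structures.
From mathcomp Require Import all_boot all_algebra.
From mathcomp Require Import boolp.
From mathcomp.multinomials Require Import monalg.

Set Implicit Arguments.
Unset Strict Implicit.
Unset Printing Implicit Defensive.

Import GRing.Theory.
Import Quotient.

Local Open Scope ring_scope.
Local Open Scope quotient_scope.

(* [ring_quotient] only puts a ring structure on quotients of commutative     *)
(* rings, hence the following construction. Membership in an ideal given by   *)
(* generators is not decidable in general, hence the classical [asbool].      *)
Definition two_sided_ideal (A : nzRingType) (S : seq A) : {pred A} :=
  fun p => `[< exists2 t : seq (A * A * A),
                 all (fun ugv => ugv.1.2 \in S) t
               & p = \sum_(ugv <- t) ugv.1.1 * ugv.1.2 * ugv.2 >].

Section TwoSidedIdeal.
Context (A : nzRingType) (S : seq A).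
Local Notation I := (two_sided_ideal S).

Lemma two_sided_idealP p :
  reflect (exists2 t : seq (A * A * A),
             all (fun ugv => ugv.1.2 \in S) t
           & p = \sum_(ugv <- t) ugv.1.1 * ugv.1.2 * ugv.2)
          (p \in I).
Proof. exact: asboolP. Qed.

Lemma two_sided_ideal_gen g : g \in S -> g \in I.
Proof.
move=> gS; apply/two_sided_idealP; exists [:: (1, g, 1)].
  by rewrite /= gS.
by rewrite big_seq1 /= mul1r mulr1.
Qed.

Lemma two_sided_idealMl u p : p \in I -> u * p \in I.
Proof.
case/two_sided_idealP=> t tS ->; apply/two_sided_idealP.
exists [seq (u * x.1.1, x.1.2, x.2) | x <- t]; first by rewrite all_map.
by rewrite big_map mulr_sumr; apply: eq_bigr => x _ /=; rewrite !mulrA.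
Qed.

Lemma two_sided_idealMr u p : p \in I -> p * u \in I.
Proof.
case/two_sided_idealP=> t tS ->; apply/two_sided_idealP.
exists [seq (x.1.1, x.1.2, x.2 * u) | x <- t]; first by rewrite all_map.
by rewrite big_map mulr_suml; apply: eq_bigr => x _ /=; rewrite !mulrA.
Qed.

Lemma two_sided_ideal_zmod_closed : zmod_closed I.
Proof.
split=> [|p q].
  by apply/two_sided_idealP; exists [::]; rewrite ?big_nil.
move=> /two_sided_idealP[t tS ->].
rewrite -mulN1r => /(two_sided_idealMl (-1)) /two_sided_idealP[s sS ->].
apply/two_sided_idealP; exists (t ++ s); first by rewrite all_cat tS.
by rewrite big_cat.
Qed.

HB.instance Definition _ :=
  GRing.isZmodClosed.Build A (two_sided_ideal S) two_sided_ideal_zmod_closed.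

Definition quot_ring := {quot two_sided_ideal S}.

HB.instance Definition _ := GRing.Zmodule.on quot_ring.

Definition quot_proj (p : A) : quot_ring := \pi_{quot two_sided_ideal S} p.

Lemma quot_projP p q : reflect (quot_proj p = quot_proj q) (p - q \in I).
Proof. by rewrite idealrBE; apply: eqP. Qed.

Lemma quot_proj_surj x : exists p, x = quot_proj p.
Proof. by exists (repr x); rewrite /quot_proj reprK. Qed.

Lemma quot_proj_is_zmod_morphism : zmod_morphism quot_proj.
Proof. by move=> p q; rewrite /quot_proj !piE. Qed.

HB.instance Definition _ :=
  GRing.isZmodMorphism.Build A quot_ring quot_proj quot_proj_is_zmod_morphism.

Definition quot_mul (x y : quot_ring) : quot_ring :=
  quot_proj (repr x * repr y).

Lemma quot_projM : {morph quot_proj : p q / p * q >-> quot_mul p q}.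
Proof.
move=> p q; apply/quot_projP.
have projK r : r - repr (quot_proj r) \in I.
  by apply/quot_projP; rewrite {2}/quot_proj reprK.
set p' := repr _; set q' := repr _.
have -> : p * q - p' * q' = (p - p') * q + p' * (q - q').
  by rewrite mulrBl mulrBr addrA subrK.
by rewrite rpredD //; [apply: two_sided_idealMr|apply: two_sided_idealMl].
Qed.

Lemma quot_mulA : associative quot_mul.
Proof.
move=> x y z.
have [p ->] := quot_proj_surj x; have [q ->] := quot_proj_surj y.
have [r ->] := quot_proj_surj z.
by rewrite -!quot_projM mulrA.
Qed.

Lemma quot_mul1r : left_id (quot_proj 1) quot_mul.
Proof. by move=> x; have [p ->] := quot_proj_surj x; rewrite -quot_projM mul1r. Qed.

Lemma quot_mulr1 : right_id (quot_proj 1) quot_mul.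
Proof. by move=> x; have [p ->] := quot_proj_surj x; rewrite -quot_projM mulr1. Qed.

Lemma quot_mulDl : left_distributive quot_mul +%R.
Proof.
move=> x y z.
have [p ->] := quot_proj_surj x; have [q ->] := quot_proj_surj y.
have [r ->] := quot_proj_surj z.
by rewrite -raddfD -!quot_projM -raddfD mulrDl.
Qed.

Lemma quot_mulDr : right_distributive quot_mul +%R.
Proof.
move=> x y z.
have [p ->] := quot_proj_surj x; have [q ->] := quot_proj_surj y.
have [r ->] := quot_proj_surj z.
by rewrite -raddfD -!quot_projM -raddfD mulrDr.
Qed.

HB.instance Definition _ := GRing.Zmodule_isPzRing.Build quot_ring
  quot_mulA quot_mul1r quot_mulr1 quot_mulDl quot_mulDr.

Lemma quot_proj_is_monoid_morphism : monoid_morphism quot_proj.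
Proof. by split=> // p q; rewrite quot_projM. Qed.

HB.instance Definition _ :=
  GRing.isMonoidMorphism.Build A quot_ring quot_proj
    quot_proj_is_monoid_morphism.

End TwoSidedIdeal.

Section QuotientModule.
Context (k : comNzRingType) (A : algType k) (S : seq A).
Local Notation Q := (quot_ring S).
Local Notation pi := (@quot_proj A S).

Definition quot_scale (s : k) (x : Q) : Q := pi (s *: repr x).

Lemma quot_projZ s p : pi (s *: p) = quot_scale s (pi p).
Proof.
apply/quot_projP; rewrite -scalerBr -mulr_algl two_sided_idealMl //.
by apply/quot_projP; rewrite {2}/quot_proj reprK.
Qed.

Lemma quot_scaleA s t x : quot_scale s (quot_scale t x) = quot_scale (s * t) x.
Proof. by have [p ->] := quot_proj_surj x; rewrite -!quot_projZ scalerA. Qed.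

Lemma quot_scale1 : left_id 1 quot_scale.
Proof. by move=> x; have [p ->] := quot_proj_surj x; rewrite -!quot_projZ scale1r. Qed.

Lemma quot_scaleDr : right_distributive quot_scale +%R.
Proof.
move=> s x y.
have [p ->] := quot_proj_surj x; have [q ->] := quot_proj_surj y.
by rewrite -raddfD -!quot_projZ -raddfD scalerDr.
Qed.

Lemma quot_scaleDl x : {morph quot_scale^~ x : s t / s + t}.
Proof.
move=> s t; have [p ->] := quot_proj_surj x.
by rewrite -!quot_projZ -raddfD scalerDl.
Qed.

HB.instance Definition _ := GRing.Zmodule_isLmodule.Build k Q
  quot_scaleA quot_scale1 quot_scaleDr quot_scaleDl.

HB.instance Definition _ := GRing.isScalable.Build k A Q *:%R pi quot_projZ.

End QuotientModule.

Definition free_algebra (k : comNzRingType) (n : nat) : Type :=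
  {malg k[{fmonom 'I_n}]}.

(* [multinomials] only makes monoid algebras of commutative monoids into      *)
(* [algType]s.                                                                *)
Section FreeAlgebra.
Context (k : comNzRingType) (n : nat).

HB.instance Definition _ := GRing.Lalgebra.on (free_algebra k n).

Lemma free_algebra_scalerAr (s : k) (p q : free_algebra k n) :
  s *: (p * q) = p * (s *: q).
Proof.
suff comm_malgC : @malgC {fmonom 'I_n} k s * p = p * malgC s.
  rewrite -[s *: (p * q)](@mul_malgC {fmonom 'I_n} k).
  by rewrite -[s *: q](@mul_malgC {fmonom 'I_n} k) !mulrA comm_malgC.
rewrite [LHS](@fgmulUg {fmonom 'I_n} k) [RHS](@fgmulgU {fmonom 'I_n} k).
by apply: eq_bigr => m _; rewrite mul1m mulm1 mulrC.
Qed.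

HB.instance Definition _ :=
  GRing.Lalgebra_isAlgebra.Build k (free_algebra k n) free_algebra_scalerAr.

Definition fvar (i : 'I_n) : free_algebra k n := << fmu i >>.

Definition const_coef (p : free_algebra k n) : k :=
  @mcoeff {fmonom 'I_n} k (@mone {fmonom 'I_n}) p.

Lemma const_coef_is_zmod_morphism : zmod_morphism const_coef.
Proof. exact: (@raddfB _ _ (@mcoeff {fmonom 'I_n} k (@mone {fmonom 'I_n}))). Qed.

HB.instance Definition _ := GRing.isZmodMorphism.Build (free_algebra k n) k
  const_coef const_coef_is_zmod_morphism.

Lemma const_coef_is_monoid_morphism : monoid_morphism const_coef.
Proof.
split; first exact: (@rmorph1 _ _ (@mcoeff {fmonom 'I_n} k (@mone {fmonom 'I_n}))).
exact: (@rmorphM _ _ (@mcoeff {fmonom 'I_n} k (@mone {fmonom 'I_n}))).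
Qed.

HB.instance Definition _ := GRing.isMonoidMorphism.Build (free_algebra k n) k
  const_coef const_coef_is_monoid_morphism.

Lemma const_coef_fvar i : const_coef (fvar i) = 0.
Proof. by rewrite /const_coef mcoeffU1 -fdeg_eq0 fdegU. Qed.

Lemma const_coefZ s p : const_coef (s *: p) = s * const_coef p.
Proof. exact: mcoeffZ. Qed.

Lemma const_coef_term s p i : const_coef (s *: (p * fvar i)) = 0.
Proof. by rewrite const_coefZ rmorphM /= const_coef_fvar !mulr0. Qed.

End FreeAlgebra.

(* Indices are shifted: x_i is [fvar] at the ordinal i - 1. *)
Section Ralg.
Context (k : fieldType) (a b c d : k).

Local Notation x1 := (fvar k (@Ordinal 4 0 isT)).
Local Notation x2 := (fvar k (@Ordinal 4 1 isT)).
Local Notation x3 := (fvar k (@Ordinal 4 2 isT)).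
Local Notation x4 := (fvar k (@Ordinal 4 3 isT)).

Definition Rrels : seq (free_algebra k 4) :=
  [:: a *: (x4 * x3) + b *: (x3 * x4) + c *: (x3 * x2) + d *: (x4 * x1);
      a *: (x3 * x2) + b *: (x2 * x3) + c *: (x4 * x3) + d *: (x1 * x2);
      a *: (x2 * x1) + b *: (x1 * x2) + c *: (x1 * x4) + d *: (x2 * x3);
      a *: (x1 * x4) + b *: (x4 * x1) + c *: (x2 * x1) + d *: (x3 * x4);
      a *: (x3 * x1) - a *: (x1 * x3) + c *: x4 ^+ 2 - c *: x2 ^+ 2;
      b *: (x4 * x2) - b *: (x2 * x4) + d *: x3 ^+ 2 - d *: x1 ^+ 2].

Definition Ralg := quot_ring Rrels.

HB.instance Definition _ := GRing.PzRing.on Ralg.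
HB.instance Definition _ := GRing.Lmodule.on Ralg.

Definition Rproj : free_algebra k 4 -> Ralg := @quot_proj _ Rrels.

HB.instance Definition _ := GRing.RMorphism.on Rproj.
HB.instance Definition _ := GRing.Linear.on Rproj.

Lemma Rproj_surj (x : Ralg) : exists p, x = Rproj p.
Proof. exact: quot_proj_surj. Qed.

Lemma RprojP p q :
  reflect (Rproj p = Rproj q) (p - q \in two_sided_ideal Rrels).
Proof. exact: quot_projP. Qed.

(* [algType] requires 1 != 0: the relations have no constant term. *)
Lemma Rrels_const_coef : {in Rrels, forall g, const_coef g = 0}.
Proof.
suff H : all (fun g => const_coef g == 0) Rrels.
  by move=> g /(allP H) /eqP.
have D p q : const_coef p = 0 -> const_coef q = 0 ->
    const_coef (p + q : free_algebra k 4) = 0.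
  by move=> p0 q0; rewrite raddfD /= p0 q0 addr0.
have N p : const_coef p = 0 -> const_coef (- p : free_algebra k 4) = 0.
  by move=> p0; rewrite raddfN /= p0 oppr0.
rewrite /Rrels [all _ _]/=; apply/and5P; split; last (apply/andP; split).
all: rewrite ?andbT; apply/eqP.
all: apply: (D); [apply: (D); [apply: (D)|]|].
all: by [exact: const_coef_term|apply: (N); exact: const_coef_term].
Qed.

Lemma Ralg_oner_neq0 : (1 : Ralg) != 0.
Proof.
apply/eqP; rewrite -(rmorph1 Rproj) -(rmorph0 Rproj).
move/RprojP; rewrite subr0 => /two_sided_idealP[t tS E].
have /eqP := congr1 (@const_coef k 4) E; rewrite rmorph1 rmorph_sum big_seq.
rewrite big1 ?oner_eq0 // => ugv /(allP tS) /Rrels_const_coef g0.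
by rewrite !rmorphM /= g0 mulr0 mul0r.
Qed.

HB.instance Definition _ :=
  GRing.PzSemiRing_isNonZero.Build Ralg Ralg_oner_neq0.

Lemma Ralg_scalerAl (s : k) (x y : Ralg) : s *: (x * y) = s *: x * y.
Proof.
have [p ->] := Rproj_surj x; have [q ->] := Rproj_surj y.
by rewrite -rmorphM -!linearZ -rmorphM /= scalerAl.
Qed.

HB.instance Definition _ :=
  GRing.Lmodule_isLalgebra.Build k Ralg Ralg_scalerAl.

Lemma Ralg_scalerAr (s : k) (x y : Ralg) : s *: (x * y) = x * (s *: y).
Proof.
have [p ->] := Rproj_surj x; have [q ->] := Rproj_surj y.
by rewrite -rmorphM -!linearZ -rmorphM /= scalerAr.
Qed.

HB.instance Definition _ :=
  GRing.Lalgebra_isAlgebra.Build k Ralg Ralg_scalerAr.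

Definition Rvar (i : 'I_4) : Ralg := Rproj (fvar k i).

End Ralg.

Section Z1.
Context (k : fieldType) (a b c d : k).

Local Notation x1 := (Rvar a b c d (@Ordinal 4 0 isT)).
Local Notation x2 := (Rvar a b c d (@Ordinal 4 1 isT)).
Local Notation x3 := (Rvar a b c d (@Ordinal 4 2 isT)).
Local Notation x4 := (Rvar a b c d (@Ordinal 4 3 isT)).

Definition Z1 : Ralg a b c d :=
  a *: (x1 * x3 + x3 * x1) + b *: (x2 * x4 + x4 * x2)
  + c *: (x2 ^+ 2 + x4 ^+ 2) + d *: (x1 ^+ 2 + x3 ^+ 2).

End Z1.

(* Main.v *)
Require Import Defs.
From mathcomp Require Import all_boot all_algebra.
From mathcomp.multinomials Require Import monalg.

Import GRing.Theory.
Local Open Scope ring_scope.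

(** The two relations with only two parameters say that

      P = a x1 x3 + c x2^2 = a x3 x1 + c x4^2,
      Q = b x4 x2 + d x3^2 = b x2 x4 + d x1^2,

    and the sum of the four expressions is Z1, so Z1 = 2 (P + Q).  Having two
    forms of P and of Q is what makes P + Q commute with each generator: to
    compare (P + Q) x1 with x1 (P + Q), use the first form of P on the left, its
    second form on the right, and the last form of Q on both sides.  The terms
    a x1 x3 x1 and d x1^3 cancel, and there remains

      x2 (c x2 x1 + b x4 x1) - (c x1 x4 + b x1 x2) x4
        = - x2 (a x1 x4 + d x3 x4) + (a x2 x1 + d x2 x3) x4 = 0

    by two of the four-term relations.  The other generators give the same
    computation after renaming the variables and the parameters; it is therefore
    done once, in [comm_half].  An element that commutes with the generators
    commutes with everything. *)

Section Generators.
Context {k : comNzRingType} {A : algType k}.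

(** P + Q commutes with one generator [u].  Multiplying [eq_zu] by [w] on the
    left and [eq_wu] by [z] on the right produces the same two terms
    [al *: (w * u * z)] and [de *: (w * v * z)]; the other terms of these two
    products are what distinguishes (P + Q) u from u (P + Q).  The names stand
    for x1 x3 x2 x4 when [u] is x1; the roles of the pairs [(al, be)] and
    [(ga, de)], hence of P and Q, are exchanged when [u] is x2 or x4. *)
Lemma comm_half (al be ga de : k) (u v w z : A)
    (eq_P : al *: (u * v) + be *: w ^+ 2 = al *: (v * u) + be *: z ^+ 2)
    (eq_Q : ga *: (z * w) + de *: v ^+ 2 = ga *: (w * z) + de *: u ^+ 2)
    (eq_zu : al *: (u * z) + ga *: (z * u) + be *: (w * u) + de *: (v * z) = 0)
    (eq_wu : al *: (w * u) + ga *: (u * w) + be *: (u * z) + de *: (w * v) = 0) :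
  GRing.comm (al *: (u * v) + be *: w ^+ 2 + (ga *: (z * w) + de *: v ^+ 2)) u.
Proof.
(* The two forms of P are used on the two sides, one form of Q on both. *)
rewrite /GRing.comm eq_Q {2}eq_P.
have eq_wzu : ga *: (w * z * u) + be *: (w * w * u)
    = - (al *: (w * u * z) + de *: (w * v * z)).
  apply/eqP; rewrite -addr_eq0; have := congr1 ( *%R w) eq_zu.
  rewrite mulr0 !mulrDr -!scalerAr !mulrA => <-.
  by rewrite addrACA [ga *: _ + _]addrC addrA.
have eq_uwz : ga *: (u * w * z) + be *: (u * z * z)
    = - (al *: (w * u * z) + de *: (w * v * z)).
  apply/eqP; rewrite -addr_eq0; have := congr1 ( *%R^~ z) eq_wu.
  rewrite mul0r !mulrDl -!scalerAl => <-.
  by rewrite addrACA [ga *: _ + _]addrC addrA.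
rewrite !mulrDl !mulrDr -!scalerAl -!scalerAr !expr2 !mulrA.
rewrite -!addrA; congr (_ + _); rewrite !addrA; congr (_ + _).
by rewrite ![be *: _ + _]addrC eq_wzu eq_uwz.
Qed.

(** The relations enter only through the generators, so this holds for any four
    elements satisfying them, in any algebra.  For each generator, the two forms
    of P and of Q are chosen so that the squares in P + Q are those of the
    variables that [comm_half] calls [w] and [v]. *)
Lemma comm_generators {a b c d : k} {x1 x2 x3 x4 : A}
    (r1 : a *: (x4 * x3) + b *: (x3 * x4) + c *: (x3 * x2) + d *: (x4 * x1) = 0)
    (r2 : a *: (x3 * x2) + b *: (x2 * x3) + c *: (x4 * x3) + d *: (x1 * x2) = 0)
    (r3 : a *: (x2 * x1) + b *: (x1 * x2) + c *: (x1 * x4) + d *: (x2 * x3) = 0)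
    (r4 : a *: (x1 * x4) + b *: (x4 * x1) + c *: (x2 * x1) + d *: (x3 * x4) = 0)
    (eq_P : a *: (x3 * x1) + c *: x4 ^+ 2 = a *: (x1 * x3) + c *: x2 ^+ 2)
    (eq_Q : b *: (x4 * x2) + d *: x3 ^+ 2 = b *: (x2 * x4) + d *: x1 ^+ 2)
    (Z := a *: (x1 * x3 + x3 * x1) + b *: (x2 * x4 + x4 * x2)
          + c *: (x2 ^+ 2 + x4 ^+ 2) + d *: (x1 ^+ 2 + x3 ^+ 2)) :
  [/\ GRing.comm Z x1, GRing.comm Z x2, GRing.comm Z x3 & GRing.comm Z x4].
Proof.
have Z_half :
    Z = (a *: (x1 * x3) + c *: x2 ^+ 2 + (b *: (x4 * x2) + d *: x3 ^+ 2)) *+ 2.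
  (* One copy of P and of Q in each of its forms. *)
  rewrite mulr2n addrACA -{2}eq_P {2}eq_Q /Z !scalerDr.
  by rewrite [RHS](AC ((2*2)*(2*2)) ((1*3)*(7*5)*(2*4)*(8*6))).
rewrite Z_half; split; apply/commr_sym/commrMn/commr_sym.
- exact: comm_half.
- rewrite addrC -eq_P eq_Q; apply: comm_half => //.
    by rewrite [LHS](ACl (2*1*4*3)).
  by rewrite [LHS](ACl (2*1*4*3)).
- by rewrite -eq_P eq_Q; apply: comm_half.
- rewrite addrC; apply: comm_half => //.
    by rewrite [LHS](ACl (2*1*4*3)).
  by rewrite [LHS](ACl (2*1*4*3)).
Qed.

End Generators.

(** A word is built by adding letters on the left, and the words span. *)
Lemma free_algebra_ind (k : comNzRingType) (n : nat)
    (P : free_algebra k n -> Prop) :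
    P 0 -> P 1 -> (forall p q, P p -> P q -> P (p + q)) ->
    (forall s p, P p -> P (s *: p)) -> (forall i p, P p -> P (fvar k i * p)) ->
  forall p, P p.
Proof.
move=> P0 P1 PD PZ PM p; rewrite [p]monalgE.
apply: (big_ind P) => // m _.
have -> : (<< p@_m *g m >> : free_algebra k n)
    = p@_m *: (<< m >> : free_algebra k n).
  by apply/malgP=> m'; rewrite mcoeffZ !mcoeffU mulrnAr mulr1.
apply: PZ; case: m => s; elim: s => [|i s IHs].
  by rewrite -fmoneE; apply: P1.
have -> : (<< FMonom (i :: s) >> : free_algebra k n)
    = fvar k i * (<< FMonom s >> : free_algebra k n).
  rewrite /fvar [RHS](@fgmulUU {fmonom 'I_n} k) mulr1; congr (<< _ >>).
  by rewrite fmuE [RHS]fmmulE.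
exact: PM.
Qed.

(** Stated between arbitrary algebras because unification against the quotient
    ring itself tends to unfold its operations. *)
Lemma four_term_lrmorph {k : fieldType} {F B : algType k} (f : {lrmorphism F -> B})
    (a b c d : k) (p q r s t u v w : F) :
  f (a *: (p * q) + b *: (r * s) + c *: (t * u) + d *: (v * w)) =
  a *: (f p * f q) + b *: (f r * f s) + c *: (f t * f u) + d *: (f v * f w).
Proof. by rewrite !raddfD /= !linearZ /= !rmorphM. Qed.

(** The sign pattern is that of the last two relations; the conclusion separates
    the two forms of P, or of Q. *)
Lemma two_term_lrmorph {k : fieldType} {F B : algType k} (f : {lrmorphism F -> B})
    (a c : k) (p q r s t u : F) :
  f (a *: (p * q) - a *: (r * s) + c *: t ^+ 2 - c *: u ^+ 2) = 0 ->
  a *: (f p * f q) + c *: f t ^+ 2 = a *: (f r * f s) + c *: f u ^+ 2.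
Proof.
rewrite !(raddfB, raddfD) /= !linearZ /= !(rmorphM, rmorphXn) /=.
move=> rel; apply: subr0_eq.
by rewrite -[RHS]rel !scalerN !expr2 opprD addrA [LHS](ACl (1*3*2*4)).
Qed.

Section Center.
Context {k : fieldType} {a b c d : k}.

Local Notation x1 := (Rvar a b c d (@Ordinal 4 0 isT)).
Local Notation x2 := (Rvar a b c d (@Ordinal 4 1 isT)).
Local Notation x3 := (Rvar a b c d (@Ordinal 4 2 isT)).
Local Notation x4 := (Rvar a b c d (@Ordinal 4 3 isT)).

Lemma Rproj_rel g : g \in Rrels a b c d -> Rproj a b c d g = 0.
Proof.
by move=> /two_sided_ideal_gen gI; rewrite -(raddf0 (Rproj a b c d));
  apply/RprojP; rewrite subr0.
Qed.

Lemma Ralg_relations :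
  [/\ [/\ a *: (x4 * x3) + b *: (x3 * x4) + c *: (x3 * x2) + d *: (x4 * x1) = 0,
          a *: (x3 * x2) + b *: (x2 * x3) + c *: (x4 * x3) + d *: (x1 * x2) = 0,
          a *: (x2 * x1) + b *: (x1 * x2) + c *: (x1 * x4) + d *: (x2 * x3) = 0 &
          a *: (x1 * x4) + b *: (x4 * x1) + c *: (x2 * x1) + d *: (x3 * x4) = 0],
      a *: (x3 * x1) + c *: x4 ^+ 2 = a *: (x1 * x3) + c *: x2 ^+ 2 &
      b *: (x4 * x2) + d *: x3 ^+ 2 = b *: (x2 * x4) + d *: x1 ^+ 2].
Proof.
have rel i : (i < 6)%N -> Rproj a b c d (Rrels a b c d)`_i = 0.
  by move=> lti; apply/Rproj_rel/mem_nth.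
split; first split.
- by have := rel 0 isT; rewrite [nth _ _ _]/= four_term_lrmorph.
- by have := rel 1 isT; rewrite [nth _ _ _]/= four_term_lrmorph.
- by have := rel 2 isT; rewrite [nth _ _ _]/= four_term_lrmorph.
- by have := rel 3 isT; rewrite [nth _ _ _]/= four_term_lrmorph.
- by have := rel 4 isT; rewrite [nth _ _ _]/=; apply: two_term_lrmorph.
- by have := rel 5 isT; rewrite [nth _ _ _]/=; apply: two_term_lrmorph.
Qed.

Lemma Z1_comm_var i : GRing.comm (Z1 a b c d) (Rvar a b c d i).
Proof.
have com : [/\ GRing.comm (Z1 a b c d) x1, GRing.comm (Z1 a b c d) x2,
    GRing.comm (Z1 a b c d) x3 & GRing.comm (Z1 a b c d) x4].
  have [[r1 r2 r3 r4] eq_P eq_Q] := Ralg_relations.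
  exact: (comm_generators r1 r2 r3 r4 eq_P eq_Q).
case: i => [[|[|[|[|m]]]] lti]; last by discriminate lti.
all: by rewrite (bool_irrelevance lti isT); case: com.
Qed.

End Center.

Theorem proposition6p3 (k : fieldType) (hk : 2%N \notin [pchar k]) (a b c d : k) :
  forall y : Ralg a b c d, GRing.comm (Z1 a b c d) y.
Proof.
move=> y; have [p ->] := Rproj_surj y.
elim/free_algebra_ind: p => [||p q cp cq|s p cp|i p cp].
- by rewrite raddf0; apply: commr0.
- by rewrite rmorph1; apply: commr1.
- by rewrite raddfD; exact: (commrD cp cq).
- by rewrite linearZ /GRing.comm /= -scalerAr -scalerAl cp.
- by rewrite rmorphM; exact: (commrM (Z1_comm_var i) cp).
Qed.
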